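(* Let $\mu\in\mathbb R$, $\sigma^2>0$, let $q$ be the density of $Q=\mathcal N(\mu,\sigma^2)$ on $\mathbb R$, and let $p(w)=C/|w|$ with $C>0$ constant. Put $u:=\mu^2/(2\sigma^2)$. Then $\mathrm{KL}(Q\|P):=\mathbb E_Q[\log q(w)]-\mathbb E_Q[\log p(w)]$, regarded as a function of $u$, is strictly increasing on $[0,\infty)$.
   Context: The quantity $\mathrm{KL}(Q\|P)$ depends on $(\mu,\sigma^2)$ only through $u=\mu^2/(2\sigma^2)$. The improper density $p$ is treated formally as a density in the definition of $\mathrm{KL}$. *)

(* Defs.v *)
From mathcomp Require Import all_boot all_order all_algebra.
From mathcomp Require Import all_classical all_reals all_analysis.

Set Implicit Arguments.
Unset Strict Implicit.
Unset Printing Implicit Defensive.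

Import Order.TTheory GRing.Theory Num.Theory.

Local Open Scope ring_scope.
Local Open Scope ereal_scope.

(* [p] may be improper, so it is passed as a function rather than as the
   density of a probability. The value is meaningful when both expectations
   are finite; in particular, a finite value forces both to be finite. *)
Definition KL {R : realType} (Q : probability (measurableTypeR R) R) (q p : R -> R) : \bar R :=
  'E_Q[fun w => ln (q w)] - 'E_Q[fun w => ln (p w)].

(* At the (Lebesgue-null) point [w = 0] the totalized inverse gives the value
   [0] instead of [+oo]. *)
Definition log_uniform_pdf {R : realType} (C : R) : R -> R :=
  fun w => (C / `|w|)%R.

(* The second parameter of [normal_pdf] and [normal_prob] is the standard
   deviation, not the variance. *)
Definition KL_normal_log_uniform {R : realType} (C mu sigma : R) : \bar R :=
  KL (normal_prob mu sigma) (normal_pdf mu sigma) (log_uniform_pdf C).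

(* Main.v *)
Require Import Defs.
From HB Require Import structures.
From mathcomp Require Import all_boot all_order all_algebra.
From mathcomp Require Import all_classical all_reals all_analysis.
From mathcomp Require Import measurable_realfun ring lra.

(** Scaling by [sigma] shows that, with [m = |mu / sigma| = sqrt (2 u)], the
    divergence equals a constant plus [J m], where [J m] is the expectation of
    [ln |X|] under [N(m, 1)].  To see that [J] increases on [0, +oo), take
    [0 <= a < b], and let [phi_a], [phi_b] be the densities of [N(a, 1)] and
    [N(b, 1)].  The reflection [x |-> a + b - x] exchanges the two densities, so
      [2 (J b - J a) = \int (ln |x| - ln |a + b - x|) (phi_b x - phi_a x) dx].
    Both factors have the sign of [x - (a + b) / 2], because [|x| > |a + b - x|]
    and [|x - b| < |x - a|] each hold exactly when [x > (a + b) / 2]. *)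

Import Order.TTheory GRing.Theory Num.Theory.

Local Open Scope classical_set_scope.
Local Open Scope ring_scope.

(** * Affine changes of variables for Lebesgue measure and for normal laws *)

Definition affine {R : realType} (k h : R) :
  measurableTypeR R -> measurableTypeR R := fun x => k * x + h.

Lemma measurable_affine {R : realType} (k h : R) :
  measurable_fun setT (affine k h).
Proof. by apply: measurable_funD => //; exact: measurable_funM. Qed.

(** Uniqueness of Lebesgue measure: the right-hand side is itself a measure in [A], so it is enough
    to compare lengths of half-open intervals. Negative [k] is covered because reflections are
    needed later. *)
Lemma lebesgue_measure_affine {R : realType} (k h : R) (A : set R) :
  k != 0 -> measurable A ->
  lebesgue_measure A =
    (`|k|%:E * lebesgue_measure (affine k h @^-1` A))%E.
Proof.
move=> k0 mA; have k0' : 0 <= `|k| by [].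
have [nu nuE] : exists nu : {measure set (measurableTypeR R) -> \bar R},
    forall B, nu B = (`|k|%:E * lebesgue_measure (affine k h @^-1` B))%E.
  unshelve eexists (mscale (NngNum k0') (pushforward lebesgue_measure (affine k h))).
    exact: measurable_affine.
  by [].
rewrite -nuE; apply: lebesgue_measure_unique => // _ [[a b]] _ <-; rewrite nuE.
have [k_gt0|k_lt0|/eqP] := ltgtP 0 k; last by rewrite eq_sym (negbTE k0).
- have -> : affine k h @^-1` `]a, b] = `](a - h) / k, (b - h) / k]%classic.
    by apply/seteqP; split => x /=; rewrite !in_itv/= /affine ltr_pdivrMr//
      ler_pdivlMr// (mulrC x) ltrBlDr lerBrDr.
  rewrite !lebesgue_measure_itv/= !lte_fin ltr_pM2r ?invr_gt0// ltrD2r.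
  case: ifPn => _; last by rewrite mule0.
  by rewrite gtr0_norm// -!EFinD -EFinM; congr EFin; field.
(* For [k < 0] the endpoints are exchanged and the preimage is closed on the left instead; its
   length is unaffected. *)
- have -> : affine k h @^-1` `]a, b] = `[(b - h) / k, (a - h) / k[%classic.
    by apply/seteqP; split => x /=; rewrite !in_itv/= /affine ltr_ndivlMr//
      ler_ndivrMr// (mulrC x) ltrBlDr lerBrDr andbC.
  rewrite !lebesgue_measure_itv/= !lte_fin ltr_nM2r ?invr_lt0// ltrD2r.
  case: ifPn => _; last by rewrite mule0.
  by rewrite ltr0_norm// -!EFinD -EFinM; congr EFin; field; rewrite ?lt_eqF.
Qed.

Lemma ge0_integral_lebesgue_affine {R : realType} (k h : R) (D : set R)
    (f : R -> \bar R) :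
  k != 0 -> measurable D -> measurable_fun D f ->
  (forall x, D x -> (0 <= f x)%E) ->
  (\int[lebesgue_measure]_(x in D) f x =
   `|k|%:E * \int[lebesgue_measure]_(x in affine k h @^-1` D) f (affine k h x))%E.
Proof.
move=> k0 mD mf f0; have k0' : 0 <= `|k| by [].
rewrite -(ge0_integral_pushforward (measurable_affine k h) lebesgue_measure mD mf);
  last by move=> x /set_mem/f0.
rewrite -[`|k|]/((NngNum k0')%:num) -ge0_integral_mscale//.
  exact: measurable_affine.
move=> mphi; apply: eq_measure_integral => A mA AD; exact: lebesgue_measure_affine.
Qed.

(** The Jacobian [|k|] cancels the factor that the standard deviation [|k| * s] contributes to the
    peak, and the two exponents coincide. *)
Lemma normal_pdf_affine {R : realType} (m s k h x : R) : k != 0 -> s != 0 ->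
  `|k| * normal_pdf (k * m + h) (`|k| * s) (affine k h x) = normal_pdf m s x.
Proof.
move=> k0 s0; have ks0 : `|k| * s != 0 by rewrite mulf_neq0// normr_eq0.
rewrite !normal_pdfE//; cbv beta; rewrite mulrA; congr (_ * _).
  rewrite /normal_peak exprMn -mulrA -mulrnAr sqrtrM ?sqr_ge0// sqrtr_sqr normr_id.
  by rewrite invfM mulrA divff ?normr_eq0// mul1r.
rewrite /normal_fun; congr expR; rewrite exprMn real_normK ?num_real// /affine.
by field; rewrite s0 k0.
Qed.

Lemma normal_prob_affine {R : realType} (m s k h : R) (A : set R) :
  k != 0 -> s != 0 -> measurable A ->
  normal_prob (k * m + h) (`|k| * s) A = normal_prob m s (affine k h @^-1` A).
Proof.
move=> k0 s0 mA; rewrite /normal_prob (ge0_integral_lebesgue_affine k h)//.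
- rewrite -ge0_integralZl//.
  + by apply: eq_integral => x _; rewrite -EFinM normal_pdf_affine.
  + by rewrite -[X in measurable X]setTI; exact: measurable_affine.
  + apply/measurable_EFinP/measurable_funTS.
    apply: (measurableT_comp (measurable_normal_pdf _ _)).
    exact: measurable_affine.
  + by move=> x _; rewrite lee_fin normal_pdf_ge0.
- by apply/measurable_EFinP/measurable_funTS; exact: measurable_normal_pdf.
- by move=> x _; rewrite lee_fin normal_pdf_ge0.
Qed.

(** Applied to [|f|], this gives the integrability of [f \o affine k h], which the pushforward
    formula for signed functions requires. *)
Lemma ge0_integral_normal_prob_affine {R : realType} (m s k h : R)
    (f : R -> \bar R) :
  k != 0 -> s != 0 -> measurable_fun setT f -> (forall x, (0 <= f x)%E) ->
  (\int[normal_prob (k * m + h)%R (`|k| * s)%R]_x f x =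
   \int[normal_prob m s]_x f (affine k h x))%E.
Proof.
move=> k0 s0 mf f0.
rewrite -(ge0_integral_pushforward (measurable_affine k h) (normal_prob m s)
  measurableT mf); last by move=> x _; exact: f0.
apply: eq_measure_integral; first exact: measurable_affine.
move=> mphi A mA _; exact: normal_prob_affine.
Qed.

Lemma integrable_normal_prob_affine {R : realType} (m s k h : R) (f : R -> \bar R) :
  k != 0 -> s != 0 ->
  (normal_prob (k * m + h) (`|k| * s)).-integrable setT f ->
  (normal_prob m s).-integrable setT (f \o affine k h).
Proof.
move=> k0 s0 /integrableP[mf fi]; apply/integrableP; split.
  by apply: measurableT_comp => //; exact: measurable_affine.
rewrite -(ge0_integral_normal_prob_affine m s k h (fun x => `|f x|%E))//.
exact: measurableT_comp.
Qed.

Lemma integral_normal_prob_affine {R : realType} (m s k h : R) (f : R -> \bar R) :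
  k != 0 -> s != 0 ->
  (normal_prob (k * m + h) (`|k| * s)).-integrable setT f ->
  (\int[normal_prob (k * m + h)%R (`|k| * s)%R]_x f x =
   \int[normal_prob m s]_x f (affine k h x))%E.
Proof.
move=> k0 s0 fi; have mf := measurable_int _ fi.
have fi' := integrable_normal_prob_affine m s k h f k0 s0 fi.
rewrite -(integral_pushforward (measurable_affine k h) mf fi' measurableT).
apply: eq_measure_integral; first exact: measurable_affine.
move=> mphi A mA _; exact: normal_prob_affine.
Qed.

(** * Integrals against a normal law as Lebesgue integrals against its density *)

(** Both functions have the same integral over every measurable set. This lets the change of
    variables for the abstract Radon-Nikodym derivative be used with the explicit density. *)
Lemma ae_eq_normal_pdf {R : realType} (m s : R) :
  ae_eq lebesgue_measure setT
    (Radon_Nikodym_SigmaFinite.f (normal_prob m s) lebesgue_measure)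
    (EFin \o normal_pdf m s).
Proof.
have dom := normal_prob_dominates m s.
apply: integral_ae_eq => //.
- exact: Radon_Nikodym_SigmaFinite.f_integrable.
- by apply/measurable_EFinP; exact: measurable_normal_pdf.
- by move=> E _ mE; rewrite -Radon_Nikodym_SigmaFinite.f_integral.
Qed.

Lemma ge0_integral_normal_prob {R : realType} (m s : R) (f : R -> \bar R) :
  measurable_fun setT f -> (forall x, (0 <= f x)%E) ->
  (\int[normal_prob m s]_x f x =
   \int[lebesgue_measure]_x (f x * (normal_pdf m s x)%:E))%E.
Proof.
move=> mf f0; have dom := normal_prob_dominates m s.
rewrite -(Radon_Nikodym_SigmaFinite.change_of_variables dom f0 measurableT mf).
apply: ae_eq_integral => //.
- apply: emeasurable_funM => //.
  exact: measurable_int (Radon_Nikodym_SigmaFinite.f_integrable dom).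
- apply: emeasurable_funM => //.
  by apply/measurable_EFinP; exact: measurable_normal_pdf.
- by apply: ae_eqe_mul2l; exact: ae_eq_normal_pdf.
Qed.

Lemma integrable_normal_probP {R : realType} (m s : R) (f : R -> \bar R) :
  measurable_fun setT f ->
  (normal_prob m s).-integrable setT f <->
  lebesgue_measure.-integrable setT (fun x => f x * (normal_pdf m s x)%:E)%E.
Proof.
move=> mf.
have mg : measurable_fun setT (fun x => f x * (normal_pdf m s x)%:E)%E.
  apply: emeasurable_funM => //.
  by apply/measurable_EFinP; exact: measurable_normal_pdf.
have E : (\int[normal_prob m s]_x `|f x| =
    \int[lebesgue_measure]_x `|f x * (normal_pdf m s x)%:E|)%E.
  rewrite ge0_integral_normal_prob//; last exact: measurableT_comp.
  by apply: eq_integral => x _; rewrite abseM (@gee0_abs _ (normal_pdf _ _ _)%:E)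
    ?lee_fin ?normal_pdf_ge0.
by split => /integrableP[_ fi]; apply/integrableP; split => //; rewrite ?E// -E.
Qed.

Lemma integral_normal_prob {R : realType} (m s : R) (f : R -> \bar R) :
  (normal_prob m s).-integrable setT f ->
  (\int[normal_prob m s]_x f x =
   \int[lebesgue_measure]_x (f x * (normal_pdf m s x)%:E))%E.
Proof.
move=> fi; have mf := measurable_int _ fi.
have dom := normal_prob_dominates m s.
rewrite integralE [RHS]integralE.
rewrite !ge0_integral_normal_prob//;
  [|exact: measurable_funeneg|exact: measurable_funepos].
by congr (_ - _)%E; apply: eq_integral => x _;
  rewrite ?(funeposE, funenegE) maxe_pMl ?lee_fin ?normal_pdf_ge0// mul0e ?mulNe.
Qed.

(** * Integrability of [(x - m) ^+ 2] and of [ln |x|] under a normal law *)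

(** The square times the density is dominated by a multiple of the wider normal density with
    standard deviation [sqrt 2 * s]: half of the Gaussian exponent absorbs the square. *)
Lemma integrable_normal_sqr {R : realType} (m s : R) : s != 0 ->
  (normal_prob m s).-integrable setT (fun x => ((x - m) ^+ 2)%:E).
Proof.
move=> s0; have sq2 : Num.sqrt 2 ^+ 2 = 2 :> R by rewrite sqr_sqrtr.
have s20 : Num.sqrt 2 * s != 0 by rewrite mulf_neq0// gt_eqF// sqrtr_gt0.
have msq : measurable_fun setT (fun x : R => (x - m) ^+ 2).
  by apply: measurable_funX; exact: measurable_funB.
apply/integrable_normal_probP; first exact/measurable_EFinP.
(* [K] replaces the peak of the wider density by that of the original one; the factor [4 * s ^+ 2]
   is the ratio of [(x - m) ^+ 2] to the variable [t] below. *)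
pose K := 4 * s ^+ 2 * normal_peak s / normal_peak (Num.sqrt 2 * s).
apply: (@le_integrable _ _ _ lebesgue_measure setT measurableT _
  (fun x => K%:E * (normal_pdf m (Num.sqrt 2 * s) x)%:E)%E).
- apply/measurable_EFinP; apply: measurable_funM => //.
  exact: measurable_normal_pdf.
- move=> x _; rewrite -!EFinM /= lee_fin.
  have K0 : 0 <= K.
    by rewrite mulr_ge0 ?invr_ge0 ?normal_peak_ge0// mulr_ge0 ?normal_peak_ge0//
      mulr_ge0 ?sqr_ge0.
  rewrite [leLHS]ger0_norm; last by rewrite mulr_ge0 ?sqr_ge0 ?normal_pdf_ge0.
  rewrite [leRHS]ger0_norm; last by rewrite mulr_ge0 ?normal_pdf_ge0.
  rewrite !normal_pdfE// /K; cbv beta.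
  (* In terms of [t], the domination reads [t * exp (- 2 t) <= exp (- t)]. *)
  set t := (x - m) ^+ 2 / (4 * s ^+ 2).
  have s2 : 0 < 4 * s ^+ 2 by rewrite mulr_gt0// exprn_even_gt0.
  have -> : normal_fun m s x = expR (- t) * expR (- t).
    by rewrite -expRD /normal_fun; congr expR; rewrite /t; field.
  have -> : normal_fun m (Num.sqrt 2 * s) x = expR (- t).
    rewrite /normal_fun exprMn sq2; congr expR; rewrite /t; field.
    by rewrite s0.
  have -> : (x - m) ^+ 2 = 4 * s ^+ 2 * t by rewrite /t; field.
  have p0 : normal_peak (Num.sqrt 2 * s) != 0 by rewrite gt_eqF ?normal_peak_gt0.
  have te : t * expR (- t) <= 1.
    rewrite expRN ler_pdivrMr ?expR_gt0// mul1r.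
    by apply: le_trans (expR_ge1Dx t); rewrite lerDr.
  rewrite [leLHS](_ : _ = 4 * s ^+ 2 * normal_peak s * expR (- t) * (t * expR (- t)));
    last by ring.
  rewrite [leRHS](_ : _ = 4 * s ^+ 2 * normal_peak s * expR (- t) * 1); last by field.
  by apply: ler_wpM2l te; rewrite mulr_ge0 ?expR_ge0// mulr_ge0 ?normal_peak_ge0// ltW.
- by apply: integrableZl => //; exact: integrable_normal_pdf.
Qed.

(** The density is at most its peak. This bounds the mass near the singularity of [ln |x|] and, for
    [a = b = 0], shows that the origin is a null set. *)
Lemma normal_prob_itvcc_le {R : realType} (m s a b : R) : s != 0 -> a <= b ->
  (normal_prob m s `[a, b] <= (normal_peak s * (b - a))%:E)%E.
Proof.
move=> s0 ab; rewrite /normal_prob.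
apply: (@le_trans _ _ (\int[lebesgue_measure]_(x in `[a, b]) (normal_peak s)%:E)%E).
  apply: ge0_le_integral => //=.
  - by move=> x _; rewrite lee_fin normal_pdf_ge0.
  - by apply/measurable_EFinP/measurable_funTS; exact: measurable_normal_pdf.
  - by move=> x _; rewrite lee_fin normal_pdf_ub.
rewrite integral_cst//= lebesgue_measure_itv/= lte_fin EFinM EFinB.
by case: ltgtP ab => // -> _; rewrite subee// mule0.
Qed.

Lemma measurable_ln_norm {R : realType} :
  measurable_fun [set: R] (fun x => ln `|x|).
Proof. by apply: measurableT_comp => //; exact: measurable_ln. Qed.

(** This controls the logarithmic singularity at the origin; the growth at infinity is left to the
    second moment. *)
Lemma integral_normal_ln_norm_neg_lty {R : realType} (m s : R) : s != 0 ->
  (\int[normal_prob m s]_x (Num.max 0 (- ln `|x|))%:E < +oo)%E.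
Proof.
move=> s0; pose X : measurableTypeR R -> R := fun x => Num.max 0 (- ln `|x|).
have mX : measurable_fun setT X.
  by apply: measurable_maxr => //; apply: measurable_funN; exact: measurable_ln_norm.
pose X_mixin := isMeasurableFun.Build _ _ _ _ X mX.
pose X' : {RV (normal_prob m s) >-> R} := HB.pack X X_mixin.
have X0 x : 0 <= X' x by rewrite /= /X le_max lexx.
(* Layer cake: [X > r] forces [|x| <= exp (- r)], whose probability is
   at most [2 * normal_peak s * exp (- r)]. *)
have := ge0_expectation_ccdf X0; rewrite unlock => ->.
(* On [[0, +oo[] the function [exp (- r)] is the exponential density of rate 1, whose total integral
   is 1. *)
apply: (@le_lt_trans _ _ (\int[lebesgue_measure]_(r in `[0%R, +oo[)
   ((normal_peak s * 2)%:E * (exponential_pdf 1 r)%:E))%E).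
  apply: ge0_le_integral => //=.
  - by apply: measurable_funTS; exact: ccdf_measurable.
  - apply/measurable_EFinP/measurable_funTS; apply: measurable_funM => //.
    exact: measurable_exponential_pdf.
  - move=> r; rewrite /= in_itv/= andbT => r0.
    rewrite exponential_pdfE// mul1r mulN1r -EFinM.
    have e0 : - expR (- r) <= expR (- r) by rewrite ge0_cp// expR_ge0.
    have := normal_prob_itvcc_le m s _ _ s0 e0.
    rewrite opprK -mulr2n -[_ *+ 2]mulr_natl mulrA; apply: le_trans.
    apply: le_measure; rewrite ?inE//.
      by rewrite -[X in measurable X]setTI; exact: (measurable_funP X').
    move=> x; rewrite /= !in_itv/= andbT /X lt_max ltNge r0/= => rx.
    rewrite -ler_norml; have [->|x0] := eqVneq x 0; first by rewrite normr0 expR_ge0.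
    rewrite -[leLHS]lnK ?posrE ?normr_gt0// ler_expR.
    by rewrite lerNr ltW.
rewrite ge0_integralZl//.
- rewrite lte_mul_pinfty//.
    by rewrite lee_fin mulr_ge0 ?normal_peak_ge0.
  apply: (@le_lt_trans _ _ (\int[lebesgue_measure]_r (exponential_pdf 1 r)%:E)%E).
    apply: ge0_subset_integral => //.
      by apply/measurable_EFinP; exact: measurable_exponential_pdf.
    by move=> r _; rewrite lee_fin exponential_pdf_ge0.
  by rewrite integral_exponential_pdf ?ltry.
- by apply/measurable_EFinP/measurable_funTS; exact: measurable_exponential_pdf.
- by move=> r _; rewrite lee_fin exponential_pdf_ge0.
- by rewrite lee_fin mulr_ge0 ?normal_peak_ge0.
Qed.

(** The dominating function is [max 0 (- ln |x|) + 2 (x - m)^2 + 1 + 2 m^2]. The first term handles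
    [|x| <= 1]; for [|x| > 1] the rest suffices, since [ln |x| <= |x| <= 1 + x^2]. *)
Lemma integrable_normal_ln_norm {R : realType} (m s : R) : s != 0 ->
  (normal_prob m s).-integrable setT (fun x => (ln `|x|)%:E).
Proof.
move=> s0; set P := normal_prob m s.
have mX : measurable_fun setT (fun x : R => Num.max 0 (- ln `|x|)).
  by apply: measurable_maxr => //; apply: measurable_funN; exact: measurable_ln_norm.
have iX : P.-integrable setT (fun x => (Num.max 0 (- ln `|x|))%:E).
  apply/integrableP; split; first exact/measurable_EFinP.
  under eq_integral do rewrite gee0_abs ?lee_fin ?le_max ?lexx//.
  exact: integral_normal_ln_norm_neg_lty.
have i1 : P.-integrable setT (fun x => (1 + m ^+ 2 *+ 2)%:E).
  exact: finite_measure_integrable_cst.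
have isq := integrableZl measurableT 2 (integrable_normal_sqr m s s0).
apply: (le_integrable measurableT _ _
  (integrableD measurableT iX (integrableD measurableT isq i1))).
  by apply/measurable_EFinP; exact: measurable_ln_norm.
move=> x _; rewrite /= lee_fin.
apply: le_trans (ler_norm _).
have q : 0 <= 2 * (x - m) ^+ 2 + (1 + m ^+ 2 *+ 2).
  by have := sqr_ge0 (x - m); have := sqr_ge0 m; lra.
have [x1|x1] := leP `|x| 1.
  have lnx0 : ln `|x| <= 0 by apply: ln_le0.
  rewrite ler0_norm//; apply: (le_trans (y := Num.max 0 (- ln `|x|))).
    by rewrite le_max lexx orbT.
  by rewrite lerDl.
have lnx0 : 0 <= ln `|x| by rewrite ln_ge0 ?ltW.
rewrite ger0_norm//; apply: (le_trans (y := `|x|)).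
  by rewrite ltW// ln_sublinear// (lt_trans _ x1).
apply: (le_trans (y := 2 * (x - m) ^+ 2 + (1 + m ^+ 2 *+ 2))); last first.
  by rewrite lerDr le_max lexx.
have x2 : `|x| <= 1 + x ^+ 2.
  by rewrite -[x ^+ 2]real_normK ?num_real//; nra.
(* The right side minus the left side is exactly [(x - 2 m)^2]. *)
by apply: (le_trans x2); have := sqr_ge0 (x - 2 * m); nra.
Qed.

(** * Strict monotonicity in the mean, by reflection *)

Lemma normal_pdf_lt {R : realType} (m1 m2 s x : R) : s != 0 ->
  `|x - m1| < `|x - m2| -> normal_pdf m2 s x < normal_pdf m1 s x.
Proof.
move=> s0 xm; rewrite !normal_pdfE//; cbv beta.
rewrite ltr_pM2l ?normal_peak_gt0// /normal_fun ltr_expR !mulNr ltrN2.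
rewrite ltr_pM2r ?invr_gt0 ?pmulrn_lgt0 ?exprn_even_gt0//.
by rewrite -[ltLHS]real_normK ?num_real// -[ltRHS]real_normK ?num_real// ltr_pXn2r ?nnegrE.
Qed.

(** Comparing squares reduces both signs to that of [2 x - (a + b)]: the differences factor as
    [(a + b) (2 x - (a + b))] and [(b - a) (2 x - (a + b))], with [a + b > 0] and [b - a > 0]. At
    the midpoint both factors vanish; at [0] and [a + b] one logarithm takes its default value. *)
Lemma ln_norm_reflect_gt0 {R : realType} (a b s x : R) : s != 0 ->
  0 <= a -> a < b -> x != 0 -> x != a + b -> x != (a + b) / 2 ->
  0 < (ln `|x| - ln `|a + b - x|) * (normal_pdf b s x - normal_pdf a s x).
Proof.
move=> s0 a0 ab x0 xab xc.
have y0 : a + b - x != 0 by rewrite subr_eq0 eq_sym.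
have [cx|xc'|/eqP] := ltgtP ((a + b) / 2) x; last by rewrite eq_sym (negbTE xc).
- have x_gt : 0 < 2 * x - (a + b) by lra.
  rewrite mulr_gt0// subr_gt0.
    rewrite ltr_ln ?posrE ?normr_gt0// -ltr_sqr ?nnegrE// !real_normK ?num_real//.
    rewrite -subr_gt0 (_ : _ - _ = (a + b) * (2 * x - (a + b))); last by ring.
    by rewrite mulr_gt0//; lra.
  apply: normal_pdf_lt => //; rewrite -ltr_sqr ?nnegrE// !real_normK ?num_real//.
  rewrite -subr_gt0 (_ : _ - _ = (b - a) * (2 * x - (a + b))); last by ring.
  by rewrite mulr_gt0//; lra.
- have x_lt : 0 < (a + b) - 2 * x by lra.
  rewrite nmulr_rgt0 subr_lt0.
    apply: normal_pdf_lt => //; rewrite -ltr_sqr ?nnegrE// !real_normK ?num_real//.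
    rewrite -subr_gt0 (_ : _ - _ = (b - a) * ((a + b) - 2 * x)); last by ring.
    by rewrite mulr_gt0//; lra.
  rewrite ltr_ln ?posrE ?normr_gt0// -ltr_sqr ?nnegrE// !real_normK ?num_real//.
  rewrite -subr_gt0 (_ : _ - _ = (a + b) * ((a + b) - 2 * x)); last by ring.
  by rewrite mulr_gt0//; lra.
Qed.

(** If the integral were zero, [f] would vanish almost everywhere off [A]. As [f] is positive there,
    the complement of [A] would be null as well, and so would the whole line. *)
Lemma lebesgue_integral_gt0 {R : realType} (A : set (measurableTypeR R)) (f : R -> R) :
  measurable A -> lebesgue_measure A = 0%E ->
  lebesgue_measure.-integrable setT (EFin \o f) ->
  (forall x, ~ A x -> 0 < f x) ->
  (0 < \int[lebesgue_measure]_x (f x)%:E)%E.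
Proof.
move=> mA + + f0; set mu := @lebesgue_measure R => muA fi.
have mCA := measurableC mA.
rewrite (negligible_integral mA measurableT fi muA) setTD.
have fge0 x : (~` A) x -> (0 <= (f x)%:E)%E by move=> /f0/ltW; rewrite lee_fin.
rewrite lt_neqAle integral_ge0// andbT; apply/negP => /eqP int0.
have mf : measurable_fun (~` A) (EFin \o f).
  by apply: measurable_funTS; exact: measurable_int fi.
have : ae_eq mu (~` A) (EFin \o f) (cst 0%E).
  apply/ae_eq_integral_abs => //; rewrite int0; apply: eq_integral => x /set_mem xA.
  by rewrite gee0_abs//; exact: fge0.
move=> /negligibleS => /(_ (~` A)) neg.
have : mu (~` A) = 0%E.
  apply/negligibleP => //; apply: neg => x /= nAx /(_ nAx)[fx0].
  by have := f0 _ nAx; rewrite fx0 ltxx.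
move=> muCA; have : (mu `[0%R, 1%R]%classic <= mu A + mu (~` A))%E.
  rewrite -measureU//; last by rewrite setICr.
  by apply: le_measure; rewrite ?inE//; [exact: measurableU|rewrite setUv].
by rewrite muA muCA adde0 /mu lebesgue_measure_itv/= lte_fin ltr01 oppr0 adde0 lee_fin ler10.
Qed.

Lemma integral_normal_ln_norm_lt {R : realType} (a b s : R) : s != 0 ->
  0 <= a -> a < b ->
  (\int[normal_prob a s]_x (ln `|x|)%:E < \int[normal_prob b s]_x (ln `|x|)%:E)%E.
Proof.
move=> s0 a0 ab.
(* [l'] is [ln |a + b - x|]. The reflection turns the mean [m] into [a + b - m] and keeps [s], so
   facts about [l'] come from facts about [l] at the reflected mean. *)
pose l (x : R) := (ln `|x|)%:E; pose l' := l \o affine (-1) (a + b).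
have k0 : -1 != 0 :> R by rewrite oppr_eq0 oner_eq0.
have li m : (normal_prob m s).-integrable setT l by exact: integrable_normal_ln_norm.
have reflE m : -1 * m + (a + b) = a + b - m by rewrite mulN1r addrC.
have l'i m : (normal_prob m s).-integrable setT l'.
  apply: integrable_normal_prob_affine => //.
  by rewrite reflE normrN1 mul1r; exact: li.
pose J m := (\int[normal_prob m s]_x l x)%E.
have l'E m : (\int[normal_prob m s]_x l' x)%E = J (a + b - m).
  have := integral_normal_prob_affine m s (-1) (a + b) l k0 s0.
  by rewrite reflE normrN1 mul1r => /(_ (li _))/esym.
pose mu := @lebesgue_measure R.
pose h (f : R -> \bar R) m x := (f x * (normal_pdf m s x)%:E)%E.
have hi m f : (normal_prob m s).-integrable setT f -> mu.-integrable setT (h f m).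
  by move=> fi; exact: (integrable_normal_probP m s f (measurable_int _ fi)).1 fi.
have i1 := integrableB measurableT (hi _ _ (li b)) (hi _ _ (li a)).
have i2 := integrableB measurableT (hi _ _ (l'i a)) (hi _ _ (l'i b)).
(* Expanding the product gives four integrable terms. Those with [l] integrate to [J b - J a], and
   those with [l'] give the same after reflection, so the integral of [g] is [2 (J b - J a)]. *)
pose g x := (ln `|x| - ln `|a + b - x|) * (normal_pdf b s x - normal_pdf a s x).
have gE : EFin \o g = ((h l b \- h l a) \+ (h l' a \- h l' b))%E.
  apply/funext => x; rewrite /h /l' /l /= /affine -!EFinM -!EFinB -EFinD; congr EFin.
  by rewrite mulN1r [- x + _]addrC /g; ring.
have gi : mu.-integrable setT (EFin \o g).
  by rewrite gE; exact: integrableD i1 i2.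
pose A : set (measurableTypeR R) := [set 0] `|` [set a + b] `|` [set (a + b) / 2].
have mA : measurable A.
  by apply: measurableU; [apply: measurableU|]; exact: measurable_set1.
have null1 (x : measurableTypeR R) : mu.-negligible [set x].
  exact: (negligibleP mu (measurable_set1 x)).2 (lebesgue_measure_set1 x).
have muA : mu A = 0%E.
  exact: measure_negligible mA (negligibleU (negligibleU (null1 _) (null1 _)) (null1 _)).
have gA x : ~ A x -> 0 < g x.
  move=> nAx; apply: (ln_norm_reflect_gt0 a b s x s0 a0 ab); apply/eqP => xE; apply: nAx.
  - by left; left.
  - by left; right.
  - by right.
have := lebesgue_integral_gt0 A g mA muA gi gA.
have -> : (\int[mu]_x (g x)%:E = \int[mu]_x ((h l b \- h l a) x + (h l' a \- h l' b) x))%E.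
  by apply: eq_integral => x _; rewrite -[LHS]/((EFin \o g) x) gE.
rewrite (integralD measurableT i1 i2).
rewrite (integralB measurableT (hi _ _ (li b)) (hi _ _ (li a))).
rewrite (integralB measurableT (hi _ _ (l'i a)) (hi _ _ (l'i b))).
have lE m : (\int[mu]_x h l m x)%E = J m by exact/esym/(integral_normal_prob m s l (li m)).
have l'E' m : (\int[mu]_x h l' m x)%E = J (a + b - m).
  by rewrite -l'E; exact/esym/(integral_normal_prob m s l' (l'i m)).
rewrite (lE b) (lE a) (l'E' a) (l'E' b) (_ : a + b - a = b); last by ring.
rewrite addrK.
have Jfin m : J m \is a fin_num by exact: (integrable_fin_num measurableT (li m)).
move=> J_pos; change (J a < J b)%E; move: J_pos.
move: (J a) (J b) (Jfin a) (Jfin b) => [u| |] [v| |]// _ _.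
by rewrite -!EFinB -EFinD !lte_fin; lra.
Qed.

(** * Reduction of the two expectations to standardized normal laws *)

(* Needed because [ln] takes the junk value [0] at [0], so that identities such
   as [ln (C / |x|) = ln C - ln |x|] fail there. *)
Lemma eq_integral_normal_neq0 {R : realType} (m s : R)
    (f g : measurableTypeR R -> \bar R) :
  s != 0 -> measurable_fun setT f -> measurable_fun setT g ->
  (forall x, x != 0 -> f x = g x) ->
  (\int[normal_prob m s]_x f x = \int[normal_prob m s]_x g x)%E.
Proof.
move=> s0 mf mg fg; apply: ae_eq_integral => //.
exists [set 0]; split; first exact: measurable_set1.
  apply/eqP; rewrite eq_le measure_ge0 andbT -set_itv1.
  have := normal_prob_itvcc_le m s 0 0 s0 (lexx 0).
  by rewrite subrr mulr0.
move=> x /= /not_implyP[_ fgx]; apply: contrapT => /eqP x0.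
by apply: fgx; exact: fg.
Qed.

Lemma integral_probability_cst {d : measure_display} {T : measurableType d}
    {R : realType} (P : probability T R) (r : R) :
  (\int[P]_x (EFin \o cst r) x = r%:E)%E.
Proof. by have := expectation_cst P r; rewrite unlock. Qed.

Lemma ln_normal_pdf {R : realType} (m s x : R) : s != 0 ->
  ln (normal_pdf m s x) = ln (normal_peak s) - (x - m) ^+ 2 / (s ^+ 2 *+ 2).
Proof.
move=> s0; rewrite normal_pdfE//; cbv beta.
by rewrite lnM ?posrE ?normal_peak_gt0 ?expR_gt0// expRK mulNr.
Qed.

Lemma integrable_normal_ln_pdf {R : realType} (m s : R) : s != 0 ->
  (normal_prob m s).-integrable setT (fun x => (ln (normal_pdf m s x))%:E).
Proof.
move=> s0.
have i1 := finite_measure_integrable_cst (normal_prob m s) (ln (normal_peak s)) measurableT.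
have i2 := integrableZl measurableT (s ^+ 2 *+ 2)^-1 (integrable_normal_sqr m s s0).
suff -> : (fun x => (ln (normal_pdf m s x))%:E) =
    ((EFin \o cst (ln (normal_peak s))) \-
     (fun x => ((s ^+ 2 *+ 2)^-1)%:E * ((x - m) ^+ 2)%:E))%E.
  exact: (integrableB measurableT i1 i2).
by apply/funext => x; rewrite ln_normal_pdf//= [X in (_ - X)%:E]mulrC.
Qed.

(** Under [x |-> s * x + m] the density is that of [N(0, 1)] divided by [s], so its logarithm shifts
    by [- ln s]. *)
Lemma integral_normal_ln_pdf {R : realType} (m s : R) : 0 < s ->
  (\int[normal_prob m s]_x (ln (normal_pdf m s x))%:E =
   \int[normal_prob 0 1]_x (ln (normal_pdf 0 1 x))%:E - (ln s)%:E)%E.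
Proof.
move=> s0; have sn0 : s != 0 by rewrite gt_eqF.
have mE : s * 0 + m = m by rewrite mulr0 add0r.
have sE : `|s| * 1 = s by rewrite mulr1 gtr0_norm.
have := integral_normal_prob_affine 0 1 s m (fun x => (ln (normal_pdf m s x))%:E)
  sn0 (oner_neq0 R).
rewrite mE sE => /(_ (integrable_normal_ln_pdf _ _ sn0)) ->.
have i1 := integrable_normal_ln_pdf (0 : R) 1 (oner_neq0 R).
have i2 := finite_measure_integrable_cst (normal_prob 0 1) (ln s) measurableT.
transitivity (\int[normal_prob 0 1]_x
    ((fun x => (ln (normal_pdf 0 1 x))%:E) \- (EFin \o cst (ln s))) x)%E.
  apply: eq_integral => x _ /=; rewrite -EFinB; congr EFin.
  rewrite -[in RHS](normal_pdf_affine 0 1 s m x sn0 (oner_neq0 R)) mE sE gtr0_norm//.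
  rewrite lnM ?posrE//; last by rewrite normal_pdfE//= mulr_gt0 ?normal_peak_gt0 ?expR_gt0.
  by rewrite addrC addKr.
rewrite (integralB measurableT i1 i2); congr (_ - _)%E; exact: integral_probability_cst.
Qed.

(** Scaling without translation turns [ln |x|] into [ln |x| + ln s], so the mean survives as
    [|m / s|] instead of being removed. *)
Lemma integral_normal_ln_norm_standardize {R : realType} (m s : R) : 0 < s ->
  (\int[normal_prob m s]_x (ln `|x|)%:E =
   \int[normal_prob `|m / s|%R 1]_x (ln `|x|)%:E + (ln s)%:E)%E.
Proof.
move=> s0; have sn0 : s != 0 by rewrite gt_eqF.
(* Taking [k] of the sign of [m] centers the standardized law at [|m / s|]. *)
have [k [k0 ks km]] : exists k : R, [/\ k != 0, `|k| = s & k * `|m / s| = m].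
  have [m0|m0] := leP 0 m.
    have ms : 0 <= m / s by rewrite divr_ge0// ltW.
    exists s; split; [by []|by rewrite gtr0_norm|].
    by rewrite (ger0_norm ms) mulrC divfK.
  have ms : m / s < 0 by rewrite pmulr_llt0 ?invr_gt0.
  exists (- s); split; [by rewrite oppr_eq0|by rewrite normrN gtr0_norm|].
  by rewrite (ltr0_norm ms) mulrNN mulrC divfK.
set M := `|m / s|.
have mE : k * M + 0 = m by rewrite addr0.
have sE : `|k| * 1 = s by rewrite mulr1.
have := integral_normal_prob_affine M 1 k 0 (fun x => (ln `|x|)%:E) k0 (oner_neq0 R).
rewrite mE sE => /(_ (integrable_normal_ln_norm _ _ sn0)) ->.
have i1 := integrable_normal_ln_norm M 1 (oner_neq0 R).
have i2 := finite_measure_integrable_cst (normal_prob M 1) (ln s) measurableT.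
transitivity (\int[normal_prob M 1]_x
    ((fun x => (ln `|x|)%:E) \+ (EFin \o cst (ln s))) x)%E.
  (* At [x = 0] the left integrand is [ln 0 = 0] while the right one is [ln s]; the origin has to be
     discarded. *)
  apply: eq_integral_normal_neq0 => //.
  - apply: (measurableT_comp (f := fun x : R => (ln `|x|)%:E)); last exact: measurable_affine.
    by apply/measurable_EFinP; exact: measurable_ln_norm.
  - exact: (measurable_int _ (integrableD measurableT i1 i2)).
  - move=> x x0; rewrite /= /affine addr0 normrM ks -EFinD addrC.
    by rewrite lnM ?posrE ?normr_gt0.
rewrite (integralD measurableT i1 i2); congr (_ + _)%E; exact: integral_probability_cst.
Qed.

Lemma measurable_ln_log_uniform_pdf {R : realType} (C : R) : 0 < C ->
  measurable_fun [set: R] (fun x => ln (log_uniform_pdf C x)).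
Proof.
move=> C0.
(* The indicator reproduces the value at the origin, where [C / 0 = 0] and [ln 0 = 0]. *)
have -> : (fun x => ln (log_uniform_pdf C x)) =
    (fun x => (ln C - ln `|x|) * \1_(~` [set (0 : R)]) x).
  apply/funext => x; rewrite /log_uniform_pdf indicE in_setC.
  have [->|x0] := eqVneq x 0.
    by rewrite normr0 invr0 mulr0 ln0// mem_set// mulr0.
  by rewrite memNset ?mulr1 ?ln_div ?posrE ?normr_gt0//; apply/eqP.
apply: measurable_funM.
  by apply: measurable_funB => //; exact: measurable_ln_norm.
by apply: measurable_indic; apply: measurableC; exact: measurable_set1.
Qed.

Lemma integral_normal_ln_log_uniform {R : realType} (C m s : R) : 0 < C -> s != 0 ->
  (\int[normal_prob m s]_x (ln (log_uniform_pdf C x))%:E =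
   (ln C)%:E - \int[normal_prob m s]_x (ln `|x|)%:E)%E.
Proof.
move=> C0 s0.
have i1 := finite_measure_integrable_cst (normal_prob m s) (ln C) measurableT.
have i2 := integrable_normal_ln_norm m s s0.
transitivity (\int[normal_prob m s]_x
    ((EFin \o cst (ln C)) \- (fun x => (ln `|x|)%:E)) x)%E.
  apply: eq_integral_normal_neq0 => //.
  - by apply/measurable_EFinP; exact: measurable_ln_log_uniform_pdf.
  - exact: (measurable_int _ (integrableB measurableT i1 i2)).
  - by move=> x x0; rewrite /= /log_uniform_pdf ln_div ?posrE ?normr_gt0.
rewrite (integralB measurableT i1 i2); congr (_ - _)%E; exact: integral_probability_cst.
Qed.

(** The witness [f] expresses dependence on [u] alone, and its real values make the divergence
    finite. Every [u >= 0] arises, for instance from [mu = sqrt (2 u)] and [sigma = 1], so [f] is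
    determined on [[0, +oo[]. *)
Theorem corollary3 (R : realType) (C : R) (hC : 0 < C) :
  exists f : R -> R,
    (forall mu sigma : R, 0 < sigma ->
       KL_normal_log_uniform C mu sigma =
         (f (mu ^+ 2 / (2 * sigma ^+ 2)))%:E) /\
    {in `[0, +oo[ &, {homo f : u v / u < v}}.
Proof.
pose H := (\int[normal_prob 0 1]_x (ln (normal_pdf (0 : R) 1 x))%:E)%E.
pose J (m : R) := (\int[normal_prob m 1]_x (ln `|x|)%:E)%E.
have Hfin : H \is a fin_num.
  exact: (integrable_fin_num measurableT (integrable_normal_ln_pdf 0 1 (oner_neq0 R))).
have Jfin m : J m \is a fin_num.
  exact: (integrable_fin_num measurableT (integrable_normal_ln_norm m 1 (oner_neq0 R))).
(* The divergence is [(H - ln sigma) - (ln C - (J m + ln sigma))] with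
   [m = |mu / sigma| = sqrt (2 u)]; the two terms [ln sigma] cancel. *)
exists (fun u => fine H - ln C + fine (J (Num.sqrt (2 * u)))); split.
  move=> mu sigma s0; have sn0 : sigma != 0 by rewrite gt_eqF.
  rewrite /KL_normal_log_uniform /KL unlock.
  rewrite integral_normal_ln_pdf// integral_normal_ln_log_uniform//.
  rewrite integral_normal_ln_norm_standardize//.
  have -> : 2 * (mu ^+ 2 / (2 * sigma ^+ 2)) = (mu / sigma) ^+ 2 by field.
  rewrite sqrtr_sqr -/H -/(J `|mu / sigma|).
  move: H (J _) Hfin (Jfin `|mu / sigma|) => [h| |] [j| |]// _ _.
  by congr EFin; rewrite /=; ring.
move=> u v; rewrite !in_itv/= !andbT => u0 v0 uv.
rewrite ltrD2l; apply: (fine_lt (Jfin _) (Jfin _)).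
apply: (integral_normal_ln_norm_lt _ _ 1 (oner_neq0 R) (sqrtr_ge0 _)).
by rewrite ltr_sqrt ?ltr_pM2l// mulr_gt0// (le_lt_trans u0).
Qed.
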